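(* Assume (A1)–(A4) and let $b$ be consistent. Let $x^*$ be the unique solution of $\min\{f(Wx): x\in\mathscr D(W),\ Ax=b\}$ and let $y^*=Wx^*$. Then the ADMM iterates satisfy, as $k\to\infty$, $$x_k\to x^*,\quad y_k\to y^*,\quad Wx_k\to y^*,\quad f(y_k)\to f(y^* ),\quad D_{\mu_k}f(y^*,y_k)\to0.$$
   Context: $\mathcal X,\mathcal Y,\mathcal H$ are real Hilbert spaces. Standing assumptions: (A1) $A:\mathcal X\to\mathcal H$ is bounded linear. (A2) $f:\mathcal Y\to(-\infty,\infty]$ is proper, lower semicontinuous and strongly convex with constant $c_0>0$: $f(ty_1+(1-t)y_2)+c_0t(1-t)\|y_1-y_2\|^2\le tf(y_1)+(1-t)f(y_2)$ for all $y_1,y_2$, $t\in[0,1]$. (A3) $W:\mathscr D(W)\subset\mathcal X\to\mathcal Y$ is a densely defined closed linear operator. (A4) There is $c_1>0$ with $\|Ax\|^2+\|Wx\|^2\ge c_1\|x\|^2$ for all $x\in\mathscr D(W)$. $\mathscr D(f)=\{y:f(y)<\infty\}$; $b$ is consistent if $b=Ax$ for some $x\in\mathscr D(W)$ with $Wx\in\mathscr D(f)$. ADMM: fix $\rho_1,\rho_2>0$ and initial $y_0\in\mathcal Y$, $\lambda_0\in\mathcal H$, $\mu_0\in\mathcal Y$. For $k=0,1,\dots$: $x_{k+1}=\arg\min_{x\in\mathscr D(W)}\{\langle\lambda_k,Ax\rangle+\langle\mu_k,Wx\rangle+\frac{\rho_1}{2}\|Ax-b\|^2+\frac{\rho_2}{2}\|Wx-y_k\|^2\}$,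 $y_{k+1}=\arg\min_{y\in\mathcal Y}\{f(y)-\langle\mu_k,y\rangle+\frac{\rho_2}{2}\|Wx_{k+1}-y\|^2\}$, $\lambda_{k+1}=\lambda_k+\rho_1(Ax_{k+1}-b)$, $\mu_{k+1}=\mu_k+\rho_2(Wx_{k+1}-y_{k+1})$. (These minimizers exist and are unique.) One has $\mu_k\in\partial f(y_k)$ for $k\ge1$. Bregman distance: for $y$ with $\mu\in\partial f(y)$, $D_\mu f(\bar y,y)=f(\bar y)-f(y)-\langle\mu,\bar y-y\rangle$. *)

(* Defs.v *)
From Stdlib Require Import Reals Lra.
Open Scope R_scope.

Record Hilbert := mkHilbert {
  hcar :> Type;
  hadd : hcar -> hcar -> hcar;
  hopp : hcar -> hcar;
  hzero : hcar;
  hscal : R -> hcar -> hcar;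
  hinner : hcar -> hcar -> R;
  hadd_assoc : forall x y z, hadd x (hadd y z) = hadd (hadd x y) z;
  hadd_comm : forall x y, hadd x y = hadd y x;
  hadd_zero : forall x, hadd x hzero = x;
  hadd_opp : forall x, hadd x (hopp x) = hzero;
  hscal_assoc : forall a b x, hscal a (hscal b x) = hscal (a * b) x;
  hscal_one : forall x, hscal 1 x = x;
  hscal_distr_l : forall a x y, hscal a (hadd x y) = hadd (hscal a x) (hscal a y);
  hscal_distr_r : forall a b x, hscal (a + b) x = hadd (hscal a x) (hscal b x);
  hinner_sym : forall x y, hinner x y = hinner y x;
  hinner_add : forall x y z, hinner (hadd x y) z = hinner x z + hinner y z;
  hinner_scal : forall a x y, hinner (hscal a x) y = a * hinner x y;
  hinner_pos : forall x, 0 <= hinner x x;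
  hinner_def : forall x, hinner x x = 0 -> x = hzero;
  hcomplete : forall u : nat -> hcar,
    (forall eps, eps > 0 -> exists N, forall m n, (m >= N)%nat -> (n >= N)%nat ->
        sqrt (hinner (hadd (u m) (hopp (u n))) (hadd (u m) (hopp (u n)))) < eps) ->
    exists l, forall eps, eps > 0 -> exists N, forall n, (n >= N)%nat ->
        sqrt (hinner (hadd (u n) (hopp l)) (hadd (u n) (hopp l))) < eps
}.

Arguments hadd {h}. Arguments hopp {h}. Arguments hzero {h}.
Arguments hscal {h}. Arguments hinner {h}.

Definition hsub {H : Hilbert} (x y : H) : H := hadd x (hopp y).
Definition hnorm {H : Hilbert} (x : H) : R := sqrt (hinner x x).

Definition hcv {H : Hilbert} (u : nat -> H) (l : H) : Prop :=
  Un_cv (fun n => hnorm (hsub (u n) l)) 0.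

Definition bounded_linear {X Y : Hilbert} (A : X -> Y) : Prop :=
  (forall x y, A (hadd x y) = hadd (A x) (A y)) /\
  (forall a x, A (hscal a x) = hscal a (A x)) /\
  (exists C, forall x, hnorm (A x) <= C * hnorm x).

(** A linear operator with domain D(W) = {x | DW x}; the values of W outside
    its domain are irrelevant. *)
Definition linear_subspace {X : Hilbert} (D : X -> Prop) : Prop :=
  D hzero /\ (forall x y, D x -> D y -> D (hadd x y)) /\
  (forall a x, D x -> D (hscal a x)).

Definition linear_on {X Y : Hilbert} (D : X -> Prop) (W : X -> Y) : Prop :=
  linear_subspace D /\
  (forall x y, D x -> D y -> W (hadd x y) = hadd (W x) (W y)) /\
  (forall a x, D x -> W (hscal a x) = hscal a (W x)).

Definition densely_defined {X : Hilbert} (D : X -> Prop) : Prop :=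
  forall x eps, eps > 0 -> exists z, D z /\ hnorm (hsub x z) < eps.

Definition closed_operator {X Y : Hilbert} (D : X -> Prop) (W : X -> Y) : Prop :=
  forall (z : nat -> X) x y, (forall n, D (z n)) -> hcv z x ->
    hcv (fun n => W (z n)) y -> D x /\ W x = y.

Inductive ereal := Fin (r : R) | PInf.

Definition ele (a b : ereal) : Prop :=
  match a, b with
  | _, PInf => True
  | PInf, Fin _ => False
  | Fin r, Fin s => r <= s
  end.

Definition elt (a b : ereal) : Prop :=
  match a, b with
  | Fin _, PInf => True
  | PInf, _ => False
  | Fin r, Fin s => r < s
  end.

Definition eaddr (e : ereal) (r : R) : ereal :=
  match e with Fin s => Fin (s + r) | PInf => PInf end.

(** real part (junk value 0 at +oo) *)
Definition real_of (e : ereal) : R := match e with Fin r => r | PInf => 0 end.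

Definition ecv (u : nat -> ereal) (l : ereal) : Prop :=
  match l with
  | Fin a => (exists N, forall n, (n >= N)%nat -> exists r, u n = Fin r) /\
             Un_cv (fun n => real_of (u n)) a
  | PInf => forall M, exists N, forall n, (n >= N)%nat -> elt (Fin M) (u n)
  end.

Definition in_dom {Y : Type} (f : Y -> ereal) (y : Y) : Prop := exists r, f y = Fin r.

Definition proper {Y : Type} (f : Y -> ereal) : Prop := exists y, in_dom f y.

Definition lsc {Y : Hilbert} (f : Y -> ereal) : Prop :=
  forall (u : nat -> Y) y c, hcv u y -> elt (Fin c) (f y) ->
    exists N, forall n, (n >= N)%nat -> elt (Fin c) (f (u n)).

(** strong convexity with constant c0, with the convention 0 * (+oo) = 0;
    when f y1 or f y2 is +oo with positive weight the inequality is trivial *)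
Definition strongly_convex {Y : Hilbert} (f : Y -> ereal) (c0 : R) : Prop :=
  forall y1 y2 r1 r2 t, f y1 = Fin r1 -> f y2 = Fin r2 -> 0 <= t <= 1 ->
    ele (eaddr (f (hadd (hscal t y1) (hscal (1 - t) y2)))
               (c0 * t * (1 - t) * (hnorm (hsub y1 y2)) ^ 2))
        (Fin (t * r1 + (1 - t) * r2)).

Definition subdiff {Y : Hilbert} (f : Y -> ereal) (y mu : Y) : Prop :=
  exists fy, f y = Fin fy /\
    forall z, ele (Fin (fy + hinner mu (hsub z y))) (f z).

(** Bregman distance D_mu f(ybar, y) (meaningful when mu in subdiff f y
    and ybar in dom f) *)
Definition bregman {Y : Hilbert} (f : Y -> ereal) (mu ybar y : Y) : R :=
  real_of (f ybar) - real_of (f y) - hinner mu (hsub ybar y).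

Definition admm_x_obj {X Y H : Hilbert} (A : X -> H) (W : X -> Y) (b : H)
    (rho1 rho2 : R) (lam : H) (mu y : Y) (x : X) : R :=
  hinner lam (A x) + hinner mu (W x) + rho1 / 2 * (hnorm (hsub (A x) b)) ^ 2
  + rho2 / 2 * (hnorm (hsub (W x) y)) ^ 2.

Definition admm_y_obj {Y : Hilbert} (f : Y -> ereal) (rho2 : R) (mu wx : Y)
    (y : Y) : ereal :=
  eaddr (f y) (- hinner mu y + rho2 / 2 * (hnorm (hsub wx y)) ^ 2).

(* Main.v *)
Require Import Defs.
From Stdlib Require Import Reals Lra Lia.
Open Scope R_scope.

(** Write [r], [s] for the residuals [A x - b], [W x - y] and [d] for the increment of [y].
    Differencing the optimality condition of the [x]-step shows that the energy
    [rho1 |r|^2 + rho2 |s|^2 + rho2 |d|^2] is nonincreasing and drops by at least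
    [4 c0 |d|^2] at each step.  No Lagrange multiplier need exist; instead the Bregman
    distance from [y_k] to a feasible point, corrected by [d] and by the energy, decreases
    by half the energy, so the energy is summable and [y_k] is bounded.  The multipliers
    grow at most like the partial sums of the square roots [e_k] of the energies, hence
    [(|lam_k| + |mu_k|) e_k -> 0], and by optimality [<mu_m, y_n - y_m> -> 0] uniformly in
    [n >= m] as [m] tends to infinity.  Strong convexity then makes [f (y_k)] almost
    nondecreasing, so it converges and [y_k] is Cauchy.  The limit is feasible because [W]
    is closed, which identifies [lim f (y_k)] as the minimum; the strong subgradient
    inequality at [y_k], tested at the solution, finally forces [y_k] to converge to it. *)

(** * Hilbert spaces *)

Lemma hinner_add_r (V : Hilbert) (x y z : V) :
  hinner x (hadd y z) = hinner x y + hinner x z.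
Proof. now rewrite hinner_sym, hinner_add, (hinner_sym V y), (hinner_sym V z). Qed.

Lemma hinner_scal_r (V : Hilbert) a (x y : V) :
  hinner x (hscal a y) = a * hinner x y.
Proof. now rewrite hinner_sym, hinner_scal, (hinner_sym V y). Qed.

Lemma hinner_zero_l (V : Hilbert) (x : V) : hinner hzero x = 0.
Proof.
  pose proof (hinner_add V hzero hzero x) as E. rewrite hadd_zero in E. lra.
Qed.

Lemma hinner_opp_l (V : Hilbert) (x y : V) : hinner (hopp x) y = - hinner x y.
Proof.
  pose proof (hinner_add V x (hopp x) y) as E.
  rewrite hadd_opp, hinner_zero_l in E. lra.
Qed.

Lemma hinner_sub_l (V : Hilbert) (x y z : V) :
  hinner (hsub x y) z = hinner x z - hinner y z.
Proof. unfold hsub. rewrite hinner_add, hinner_opp_l. ring. Qed.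

Lemma hinner_sub_r (V : Hilbert) (x y z : V) :
  hinner x (hsub y z) = hinner x y - hinner x z.
Proof. rewrite hinner_sym, hinner_sub_l, (hinner_sym V y), (hinner_sym V z). ring. Qed.

(** Vector identities are proved throughout by testing against an arbitrary [w], which reduces them
    to [ring] goals over the reals. *)
Lemma hinner_ext (V : Hilbert) (u v : V) :
  (forall w, hinner u w = hinner v w) -> u = v.
Proof.
  intros E.
  assert (Z : hsub u v = hzero).
  { apply hinner_def. rewrite hinner_sub_l, E. ring. }
  rewrite <- (hadd_zero V u), <- (hadd_opp V v), (hadd_comm V v), hadd_assoc.
  change (hadd (hsub u v) v = v). now rewrite Z, hadd_comm, hadd_zero.
Qed.

#[local] Hint Rewrite hinner_sub_l hinner_sub_r hinner_add hinner_add_r hinner_scal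
  hinner_scal_r hinner_zero_l : hilbert.

Ltac hexpand := autorewrite with hilbert.
Ltac hexpand_in E := autorewrite with hilbert in E.

Lemma hnorm_sq (V : Hilbert) (x : V) : hnorm x ^ 2 = hinner x x.
Proof. unfold hnorm. apply pow2_sqrt, hinner_pos. Qed.

Lemma hnorm_ge0 (V : Hilbert) (x : V) : 0 <= hnorm x.
Proof. apply sqrt_pos. Qed.

Lemma sq_le_le a b : 0 <= b -> a ^ 2 <= b ^ 2 -> a <= b.
Proof. intros; nra. Qed.

Lemma cauchy_schwarz (V : Hilbert) (x y : V) :
  Rabs (hinner x y) <= hnorm x * hnorm y.
Proof.
  apply sq_le_le.
  { apply Rmult_le_pos; apply hnorm_ge0. }
  rewrite pow2_abs, Rpow_mult_distr, !hnorm_sq.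
  (* This square expands to [|y|^2 (|x|^2 |y|^2 - <x,y>^2)]; dividing by [|y|^2] requires the case
     split on [y]. *)
  pose proof (hinner_pos V (hsub (hscal (hinner y y) x) (hscal (hinner x y) y))) as P.
  hexpand_in P. rewrite (hinner_sym V y x) in P.
  pose proof (hinner_pos V y) as Py.
  destruct (Rle_lt_or_eq_dec _ _ Py) as [Hy | Hy].
  - nra.
  - assert (y = hzero) as -> by (apply hinner_def; lra).
    rewrite (hinner_sym V x), !hinner_zero_l. lra.
Qed.

Lemma hnorm_triangle (V : Hilbert) (x y : V) :
  hnorm (hadd x y) <= hnorm x + hnorm y.
Proof.
  pose proof (hnorm_ge0 V x). pose proof (hnorm_ge0 V y).
  apply sq_le_le; [lra|].
  rewrite hnorm_sq. hexpand. rewrite (hinner_sym V y x).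
  pose proof (cauchy_schwarz V x y). pose proof (Rle_abs (hinner x y)).
  pose proof (hnorm_sq V x). pose proof (hnorm_sq V y). nra.
Qed.

Lemma hnorm_scal (V : Hilbert) a (x : V) : 0 <= a -> hnorm (hscal a x) = a * hnorm x.
Proof.
  intros Ha. unfold hnorm. hexpand.
  replace (a * (a * hinner x x)) with (a ^ 2 * hinner x x) by ring.
  rewrite sqrt_mult, sqrt_pow2; auto; [nra | apply hinner_pos].
Qed.

Lemma hnorm_sub_sym (V : Hilbert) (x y : V) : hnorm (hsub x y) = hnorm (hsub y x).
Proof. unfold hnorm. f_equal. hexpand. ring. Qed.

Lemma hnorm_sub_le (V : Hilbert) (x y : V) : hnorm (hsub x y) <= hnorm x + hnorm y.
Proof.
  pose proof (hnorm_ge0 V x). pose proof (hnorm_ge0 V y).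
  apply sq_le_le; [lra|].
  rewrite hnorm_sq. hexpand. rewrite (hinner_sym V y x).
  pose proof (cauchy_schwarz V x y). pose proof (Rle_abs (- hinner x y)).
  rewrite Rabs_Ropp in *.
  pose proof (hnorm_sq V x). pose proof (hnorm_sq V y). nra.
Qed.

Lemma hnorm_sub_triangle (V : Hilbert) (x y z : V) :
  hnorm (hsub x z) <= hnorm (hsub x y) + hnorm (hsub y z).
Proof.
  replace (hsub x z) with (hadd (hsub x y) (hsub y z)); [apply hnorm_triangle|].
  apply hinner_ext; intros w. hexpand. ring.
Qed.

Lemma linear_on_sub (X Y : Hilbert) (D : X -> Prop) (W : X -> Y) (u v : X) :
  linear_on D W -> D u -> D v -> D (hsub u v) /\ W (hsub u v) = hsub (W u) (W v).
Proof.
  intros [[_ [Dadd Dscal]] [Wadd Wscal]] Hu Hv.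
  assert (E : hsub u v = hadd u (hscal (-1) v)).
  { apply hinner_ext; intros w. hexpand. ring. }
  rewrite E. split; [auto|].
  rewrite Wadd, Wscal by auto. apply hinner_ext; intros w. hexpand. ring.
Qed.

Lemma bounded_linear_sub (X Y : Hilbert) (A : X -> Y) (u v : X) :
  bounded_linear A -> A (hsub u v) = hsub (A u) (A v).
Proof.
  intros [Aadd [Ascal _]].
  assert (E : hsub u v = hadd u (hscal (-1) v)).
  { apply hinner_ext; intros w. hexpand. ring. }
  rewrite E, Aadd, Ascal. apply hinner_ext; intros w. hexpand. ring.
Qed.

(** * Optimality conditions of the two minimizations *)

Lemma linear_coef_zero a q : (forall t, 0 <= t * a + t ^ 2 * q) -> a = 0.
Proof.
  intros P. pose proof (P 1) as P1. pose proof (P (-1)) as P2.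
  assert (Hq : 0 <= q) by lra.
  (* The exact minimizer would divide by [q], which may vanish; with [q + 1] the value is still the
     negative square [- (a / (q + 1))^2]. *)
  pose proof (P (- a / (q + 1))) as P3.
  replace (- a / (q + 1) * a + (- a / (q + 1)) ^ 2 * q)
    with (- (a / (q + 1)) ^ 2) in P3 by (field; lra).
  assert (a / (q + 1) = 0) by nra.
  replace a with (a / (q + 1) * (q + 1)) by (field; lra). nra.
Qed.

Lemma nonneg_of_small_defect a q : (forall t, 0 < t < 1 -> - (t * q) <= a) -> 0 <= a.
Proof.
  intros P. apply Rnot_lt_le; intros Ha.
  pose proof (Rabs_pos q). pose proof (Rle_abs q).
  (* If [a < 0], this [t] lies in the unit interval and satisfies [t |q| <= - a / 2], contradicting
     [- a <= t q]. *)
  set (t := - a / (2 * (Rabs q - a + 1))).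
  assert (Ht : t * (2 * (Rabs q - a + 1)) = - a) by (unfold t; field; lra).
  assert (0 < t < 1) by (split; nra).
  pose proof (P t ltac:(auto)). nra.
Qed.

(** The quadratic term carries the full constant [c], with no factor one half, in line with the term
    [c0 t (1 - t)] of [strongly_convex]. *)
Definition strong_subgrad {Y : Hilbert} (f : Y -> ereal) (c : R) (mu y : Y) : Prop :=
  exists fy, f y = Fin fy /\
    forall z fz, f z = Fin fz ->
      fy + hinner mu (hsub z y) + c * hinner (hsub z y) (hsub z y) <= fz.

(* Compare y' with y' + t (z - y'), divide by t and let t tend to 0. *)
Lemma prox_strong_subgrad (Y : Hilbert) (f : Y -> ereal) (c rho : R) (mu w y' : Y) :
  proper f -> strongly_convex f c ->
  (forall z, ele (admm_y_obj f rho mu w y') (admm_y_obj f rho mu w z)) ->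
  strong_subgrad f c (hadd mu (hscal rho (hsub w y'))) y'.
Proof.
  intros [y0 [f0 Hf0]] Hsc Hmin. unfold admm_y_obj in Hmin.
  destruct (f y') as [fy|] eqn:Efy.
  2:{ specialize (Hmin y0). rewrite Hf0 in Hmin. destruct Hmin. }
  exists fy; split; [exact Efy|]. intros z fz Efz.
  set (q := hinner (hsub z y') (hsub z y')).
  assert (Hq : 0 <= q) by apply hinner_pos.
  (* After division by [t] two terms of order [t] remain: [c t q] from strong convexity and
     [rho / 2 t q] from the penalty. *)
  apply Rge_le, Rminus_ge, Rle_ge, (nonneg_of_small_defect _ ((c + rho / 2) * q)).
  intros t Ht.
  specialize (Hsc z y' fz fy t Efz Efy ltac:(lra)).
  specialize (Hmin (hadd (hscal t z) (hscal (1 - t) y'))).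
  destruct (f (hadd (hscal t z) (hscal (1 - t) y'))) as [ft|]; cbn [ele eaddr] in *; [|easy].
  rewrite !hnorm_sq in Hsc. rewrite !hnorm_sq in Hmin. fold q in Hsc.
  unfold q in *. hexpand_in Hsc. hexpand_in Hmin. hexpand.
  rewrite (hinner_sym Y y' z) in Hsc, Hmin |- *.
  rewrite (hinner_sym Y z w), (hinner_sym Y y' w) in Hmin.
  apply (Rmult_le_reg_l t); [lra|].
  nra.
Qed.

(** Along [x + t z] the objective changes by a quadratic polynomial in [t] without constant term, so
    its linear coefficient vanishes. The [x]-step uses the old [y], so the vector paired with [W z]
    is the updated [mu] plus [rho2] times the increment of [y]. *)
Lemma admm_x_optimality (X Y H : Hilbert) (A : X -> H) (D : X -> Prop) (W : X -> Y)
    (b : H) (rho1 rho2 : R) (lam : H) (mu y : Y) (x z : X) :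
  bounded_linear A -> linear_on D W -> D x -> D z ->
  (forall u, D u ->
     admm_x_obj A W b rho1 rho2 lam mu y x <= admm_x_obj A W b rho1 rho2 lam mu y u) ->
  hinner (hadd lam (hscal rho1 (hsub (A x) b))) (A z)
  + hinner (hadd mu (hscal rho2 (hsub (W x) y))) (W z) = 0.
Proof.
  intros [Aadd [Ascal _]] [[_ [Dadd Dscal]] [Wadd Wscal]] Hx Hz Hmin.
  apply (linear_coef_zero _
    (rho1 / 2 * hinner (A z) (A z) + rho2 / 2 * hinner (W z) (W z))).
  intros t. specialize (Hmin (hadd x (hscal t z)) ltac:(auto)).
  unfold admm_x_obj in Hmin.
  rewrite Aadd, Ascal, Wadd, Wscal in Hmin by auto.
  rewrite !hnorm_sq in Hmin. hexpand_in Hmin. hexpand.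
  rewrite (hinner_sym H (A z) (A x)), (hinner_sym H (A z) b) in Hmin.
  rewrite (hinner_sym Y (W z) (W x)), (hinner_sym Y (W z) y) in Hmin.
  nra.
Qed.

(** * Energy and Lyapunov function *)

Definition energy {Y H : Hilbert} (rho1 rho2 : R) (r : H) (s d : Y) : R :=
  rho1 * hinner r r + rho2 * hinner s s + rho2 * hinner d d.

(** By polarization, twice the first relation says that the energy change plus [rho1 |r' - r|^2 +
    rho2 |s' - s + d' - d|^2 + 2 rho2 <s', d'>] is zero. The squares are nonnegative, and the
    monotonicity bound makes the last term at least [4 c |d'|^2]. *)
Lemma energy_decrease (Y H : Hilbert) (rho1 rho2 c : R) (r r' : H) (s s' d d' : Y) :
  0 < rho1 -> 0 < rho2 ->
  rho1 * hinner r' (hsub r' r)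
  + rho2 * hinner (hsub (hadd s' d') d) (hadd (hsub s' s) d') = 0 ->
  2 * c * hinner d' d' <= rho2 * hinner s' d' ->
  energy rho1 rho2 r' s' d' <= energy rho1 rho2 r s d - 4 * c * hinner d' d'.
Proof.
  intros H1 H2 Hopt Hmono. unfold energy.
  assert (P1 : 0 <= rho1 * hinner (hsub r' r) (hsub r' r))
    by (apply Rmult_le_pos; [lra | apply hinner_pos]).
  assert (P2 : 0 <= rho2 * hinner (hsub (hadd (hsub s' s) d') d) (hsub (hadd (hsub s' s) d') d))
    by (apply Rmult_le_pos; [lra | apply hinner_pos]).
  hexpand_in Hopt. hexpand_in P1. hexpand_in P2.
  rewrite (hinner_sym H r r') in *.
  rewrite (hinner_sym Y s s'), (hinner_sym Y d' s'), (hinner_sym Y d' s),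
    (hinner_sym Y d s'), (hinner_sym Y d s), (hinner_sym Y d d') in *.
  lra.
Qed.

(* Intended for [v = yh - y], [fh = f yh] and [fy = f y], where [yh = W xh] with [A xh = b]. *)
Definition lyapunov {Y H : Hilbert} (rho1 rho2 c fh fy : R) (mu v : Y) (r : H) (s d : Y) : R :=
  fh - fy - hinner mu v - rho2 * hinner d v
  + rho2 / (2 * c) * energy rho1 rho2 r s d + rho2 * hinner d d.

(** The optimality relation replaces [rho2 <s' + d' - d, v'>] by
    [rho1 |r'|^2 + rho2 <s' + d' - d, s'>]. Young's inequality splits [<d, s'>] and [<d, d'>]; the
    resulting [rho2 |d|^2] is absorbed by the last term of [lyapunov]. The weight [rho2 / (2 c)]
    turns the energy drop into [2 rho2 |d'|^2], enough to leave half the energy. *)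
Lemma lyapunov_decrease (Y H : Hilbert) (rho1 rho2 c fh fy fy' : R)
    (mu v v' : Y) (r r' : H) (s s' d d' : Y) :
  0 < rho1 -> 0 < rho2 -> 0 < c ->
  v = hadd v' d' ->
  fy + hinner mu d' + c * hinner d' d' <= fy' ->
  rho2 * hinner (hsub (hadd s' d') d) (hsub v' s') = rho1 * hinner r' r' ->
  0 <= hinner s' d' ->
  energy rho1 rho2 r' s' d' <= energy rho1 rho2 r s d - 4 * c * hinner d' d' ->
  lyapunov rho1 rho2 c fh fy' (hadd mu (hscal rho2 s')) v' r' s' d'
  <= lyapunov rho1 rho2 c fh fy mu v r s d - / 2 * energy rho1 rho2 r' s' d'.
Proof.
  intros H1 H2 Hc -> Hf Hopt Hmono Hen. unfold lyapunov.
  set (M := rho2 / (2 * c)).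
  assert (HM : M * c * 2 = rho2) by (unfold M; field; lra).
  assert (HM0 : 0 <= M) by (apply Rlt_le, Rdiv_lt_0_compat; lra).
  assert (Hen' := Rmult_le_compat_l _ _ _ HM0 Hen).
  assert (M * (4 * c * hinner d' d') = 2 * rho2 * hinner d' d')
    by (rewrite <- HM; ring).
  rewrite Rmult_minus_distr_l in Hen'.
  assert (P1 : 0 <= rho2 * hinner (hsub d s') (hsub d s'))
    by (apply Rmult_le_pos; [lra | apply hinner_pos]).
  assert (P2 : 0 <= rho2 * hinner (hsub d d') (hsub d d'))
    by (apply Rmult_le_pos; [lra | apply hinner_pos]).
  assert (P3 : 0 <= rho2 * hinner s' d') by (apply Rmult_le_pos; lra).
  assert (P4 : 0 <= rho2 * hinner d' d')
    by (apply Rmult_le_pos; [lra | apply hinner_pos]).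
  assert (P5 : 0 <= c * hinner d' d')
    by (apply Rmult_le_pos; [lra | apply hinner_pos]).
  assert (P6 : 0 <= rho1 * hinner r' r')
    by (apply Rmult_le_pos; [lra | apply hinner_pos]).
  assert (HE : energy rho1 rho2 r' s' d' = rho1 * hinner r' r' + rho2 * hinner s' s'
    + rho2 * hinner d' d') by reflexivity.
  hexpand_in Hopt. hexpand_in P1. hexpand_in P2. hexpand.
  rewrite (hinner_sym Y s' d) in *.
  rewrite (hinner_sym Y d' s') in *. rewrite (hinner_sym Y d' d) in *.
  lra.
Qed.

(** Young's inequality bounds [rho2 <d, v>] by [c / 2 |v|^2 + rho2^2 / (2 c) |d|^2], and the last
    term is exactly the [d] part of the weighted energy. *)
Lemma lyapunov_lower (Y H : Hilbert) (rho1 rho2 c fh fy : R)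
    (mu v : Y) (r : H) (s d : Y) :
  0 < rho1 -> 0 < rho2 -> 0 < c ->
  fy + hinner mu v + c * hinner v v <= fh ->
  c / 2 * hinner v v <= lyapunov rho1 rho2 c fh fy mu v r s d.
Proof.
  intros H1 H2 Hc Hf. unfold lyapunov, energy.
  set (M := rho2 / (2 * c)).
  assert (HM0 : 0 <= M) by (apply Rlt_le, Rdiv_lt_0_compat; lra).
  assert (P1 : 0 <= M * (rho1 * hinner r r + rho2 * hinner s s)).
  { pose proof (hinner_pos H r). pose proof (hinner_pos Y s).
    apply Rmult_le_pos; nra. }
  assert (P2 : 0 <= rho2 * hinner d d)
    by (apply Rmult_le_pos; [lra | apply hinner_pos]).
  assert (P3 : 0 <= c / 2 * hinner (hsub v (hscal (rho2 / c) d)) (hsub v (hscal (rho2 / c) d)))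
    by (apply Rmult_le_pos; [lra | apply hinner_pos]).
  hexpand_in P3. rewrite (hinner_sym Y v d) in P3.
  assert (E : c / 2 * (rho2 / c * (rho2 / c * hinner d d)) = M * (rho2 * hinner d d))
    by (unfold M; field; lra).
  assert (E' : c / 2 * (rho2 / c * hinner d v) = rho2 * hinner d v / 2) by (field; lra).
  lra.
Qed.

(** * Real and vector sequences *)

Lemma summable_cv0 (a : nat -> R) (B : R) :
  (forall k, 0 <= a k) -> (forall n, sum_f_R0 a n <= B) ->
  Un_cv a 0 /\ Cauchy_crit (sum_f_R0 a).
Proof.
  intros Hpos HB.
  assert (Hgr : Un_growing (sum_f_R0 a)).
  { intros n. simpl. specialize (Hpos (S n)). lra. }
  assert (Hub : has_ub (sum_f_R0 a)).
  { exists B. intros z [n ->]. apply HB. }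
  destruct (growing_cv _ Hgr Hub) as [l Hl].
  assert (HC := CV_Cauchy _ (exist _ l Hl)).
  split; [|exact HC].
  intros eps Heps. destruct (HC eps Heps) as [N HN].
  exists (S N). intros n Hn. destruct n as [|n]; [lia|].
  specialize (HN (S n) n ltac:(lia) ltac:(lia)).
  unfold Rdist in *. simpl in HN.
  replace (sum_f_R0 a n + a (S n) - sum_f_R0 a n) with (a (S n)) in HN by ring.
  now rewrite Rminus_0_r.
Qed.

(* A square-summable nonincreasing [e] damps its own partial sums:
   [e n * sum_(m < j <= n) e j <= sum_(m < j <= n) (e j)^2]. *)
Lemma damped_growth_cv0 (e L : nat -> R) (c B : R) :
  0 <= c -> (forall k, 0 <= e k) -> (forall k, e (S k) <= e k) ->
  (forall n, sum_f_R0 (fun k => e k ^ 2) n <= B) ->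
  (forall k, 0 <= L k) -> (forall k, L (S k) <= L k + c * e (S k)) ->
  Un_cv e 0 /\ Un_cv (fun k => L k * e k) 0.
Proof.
  intros Hc He Hdec HB HL HLs.
  destruct (summable_cv0 (fun k => e k ^ 2) B) as [H0 HC]; [intros; nra | exact HB |].
  assert (He0 : Un_cv e 0).
  { intros eps Heps. destruct (H0 (eps ^ 2) ltac:(nra)) as [N HN].
    exists N. intros n Hn. specialize (HN n Hn). unfold Rdist in *.
    rewrite Rminus_0_r in *. specialize (He n).
    rewrite Rabs_right in * by nra. nra. }
  split; [exact He0|].
  intros eps Heps.
  destruct (HC (eps / (2 * (c + 1)))) as [m Hm].
  { apply Rdiv_lt_0_compat; lra. }
  (* The factor [t] is fixed during the induction: as [e] is nonincreasing, a [t] below [e n] is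
     below all earlier values too. It is set to [e n] at the end. *)
  assert (Hgrow : forall n, (m <= n)%nat -> forall t, 0 <= t <= e n ->
    L n * t <= L m * t
      + c * (sum_f_R0 (fun k => e k ^ 2) n - sum_f_R0 (fun k => e k ^ 2) m)).
  { intros n Hmn. induction Hmn as [|n Hmn IH]; intros t Ht; [lra|].
    specialize (IH t). specialize (Hdec n). specialize (HLs n). specialize (He (S n)).
    cbn [sum_f_R0].
    specialize (IH ltac:(lra)).
    assert (L (S n) * t <= (L n + c * e (S n)) * t) by (apply Rmult_le_compat_r; lra).
    assert (c * (e (S n) * t) <= c * (e (S n) * e (S n)))
      by (apply Rmult_le_compat_l; [lra | apply Rmult_le_compat_l; lra]).
    lra. }
  destruct (He0 (eps / (2 * (L m + 1)))) as [N HN].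
  { specialize (HL m). apply Rdiv_lt_0_compat; lra. }
  exists (max m N). intros n Hn.
  specialize (Hgrow n ltac:(lia) (e n) ltac:(specialize (He n); lra)).
  specialize (HN n ltac:(lia)). specialize (Hm n m ltac:(lia) ltac:(lia)).
  unfold Rdist in *. rewrite Rminus_0_r in *.
  pose proof (He n) as Hen. pose proof (HL m) as HLm. pose proof (HL n) as HLn.
  rewrite Rabs_right in HN by lra.
  rewrite Rabs_right by (apply Rle_ge, Rmult_le_pos; lra).
  assert (L m * e n <= eps / 2).
  { apply Rle_trans with ((L m + 1) * (eps / (2 * (L m + 1)))).
    - apply Rmult_le_compat; lra.
    - right; field; lra. }
  assert (c * (sum_f_R0 (fun k => e k ^ 2) n - sum_f_R0 (fun k => e k ^ 2) m)
    < eps / 2).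
  { apply Rabs_def2 in Hm. destruct Hm as [Hm _].
    apply Rle_lt_trans with (c * (eps / (2 * (c + 1)))).
    - apply Rmult_le_compat_l; lra.
    - apply Rlt_le_trans with ((c + 1) * (eps / (2 * (c + 1)))).
      + apply Rmult_lt_compat_r; [apply Rdiv_lt_0_compat|]; lra.
      + right; field; lra. }
  lra.
Qed.

(** Let [s] be the supremum of a tail on which [eta] is below [eps / 4]. Once some [a p] exceeds
    [s - eps / 4], all later terms stay above [s - eps / 2]. *)
Lemma almost_increasing_cv (a eta : nat -> R) (B : R) :
  (forall n, a n <= B) -> Un_cv eta 0 ->
  (forall m n, (m <= n)%nat -> a m <= a n + eta m) -> exists l, Un_cv a l.
Proof.
  intros HB Heta Hinc.
  destruct (R_complete a) as [l Hl]; [|now exists l].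
  intros eps Heps.
  destruct (Heta (eps / 4) ltac:(lra)) as [N HN].
  destruct (completeness (fun z => exists n, (n >= N)%nat /\ z = a n)) as [s [Hub Hlub]].
  { exists B. intros z [n [_ ->]]. apply HB. }
  { exists (a N), N. auto. }
  assert (Hp : exists p, (p >= N)%nat /\ s - eps / 4 < a p).
  { apply Classical_Prop.NNPP. intros Hno.
    assert (s <= s - eps / 4); [|lra].
    apply Hlub. intros z [n [Hn ->]]. apply Rnot_lt_le. intros Hlt.
    apply Hno. now exists n. }
  destruct Hp as [p [Hp Hps]]. exists p.
  assert (Hin : forall n, (n >= p)%nat -> s - eps / 2 < a n <= s).
  { intros n Hn. split.
    - specialize (Hinc p n Hn). specialize (HN p Hp).
      unfold Rdist in HN. rewrite Rminus_0_r in HN. apply Rabs_def2 in HN. lra.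
    - apply Hub. exists n. split; [lia | reflexivity]. }
  intros n m Hn Hm. specialize (Hin n Hn) as In. specialize (Hin m Hm) as Im.
  unfold Rdist. apply Rabs_def1; lra.
Qed.

Lemma abs_bounds a t : Rabs a <= t -> - t <= a <= t.
Proof. intros. unfold Rabs in *. destruct (Rcase_abs a); lra. Qed.

Lemma cv_const (a : R) : Un_cv (fun _ => a) a.
Proof. intros eps Heps. exists 0%nat. intros. now rewrite Rdist_eq. Qed.

Lemma cv0_squeeze (u a : nat -> R) :
  (forall n, Rabs (u n) <= a n) -> Un_cv a 0 -> Un_cv u 0.
Proof.
  intros Hua Ha eps Heps. destruct (Ha eps Heps) as [N HN].
  exists N. intros n Hn. specialize (HN n Hn). unfold Rdist in *.
  rewrite Rminus_0_r in *. apply Rabs_def2 in HN. specialize (Hua n). lra.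
Qed.

Lemma cv_unshift (u : nat -> R) l : Un_cv (fun n => u (S n)) l -> Un_cv u l.
Proof.
  intros Hu eps Heps. destruct (Hu eps Heps) as [N HN].
  exists (S N). intros [|n] Hn; [lia|]. apply HN. lia.
Qed.

Lemma hcv_squeeze (V : Hilbert) (u : nat -> V) (l : V) (a : nat -> R) :
  (forall n, hnorm (hsub (u n) l) <= a n) -> Un_cv a 0 -> hcv u l.
Proof.
  intros Hua Ha. apply (cv0_squeeze _ a); [|exact Ha].
  intros n. rewrite Rabs_right; [apply Hua | apply Rle_ge, hnorm_ge0].
Qed.

Lemma hcv_of_sq (V : Hilbert) (u : nat -> V) (l : V) (c : R) (a : nat -> R) :
  0 < c -> (forall n, c * hnorm (hsub (u n) l) ^ 2 <= a n) -> Un_cv a 0 -> hcv u l.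
Proof.
  intros Hc Hua Ha eps Heps.
  destruct (Ha (c * eps ^ 2)) as [N HN]; [apply Rmult_lt_0_compat; nra|].
  exists N. intros n Hn. specialize (HN n Hn). specialize (Hua n).
  pose proof (hnorm_ge0 _ (hsub (u n) l)). unfold Rdist in *.
  rewrite Rminus_0_r in *. apply Rabs_def2 in HN. rewrite Rabs_right by lra.
  assert (hnorm (hsub (u n) l) ^ 2 < eps ^ 2) by (apply (Rmult_lt_reg_l c); lra). nra.
Qed.

Lemma hcv_near (V : Hilbert) (u : nat -> V) (l : V) eps :
  hcv u l -> 0 < eps -> exists N, forall n, (n >= N)%nat -> hnorm (hsub (u n) l) < eps.
Proof.
  intros Hu Heps. destruct (Hu eps Heps) as [N HN]. exists N. intros n Hn.
  specialize (HN n Hn). unfold Rdist in HN. rewrite Rminus_0_r in HN.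
  apply Rabs_def2 in HN. lra.
Qed.

Lemma hcv_cauchy (V : Hilbert) (u : nat -> V) (l : V) :
  hcv u l -> forall eps, 0 < eps -> exists N, forall m n, (m >= N)%nat -> (n >= N)%nat ->
    hnorm (hsub (u m) (u n)) < eps.
Proof.
  intros Hu eps Heps. destruct (hcv_near V u l (eps / 2) Hu ltac:(lra)) as [N HN].
  exists N. intros m n Hm Hn. pose proof (HN m Hm) as Pm. pose proof (HN n Hn) as Pn.
  pose proof (hnorm_sub_triangle _ (u m) l (u n)) as T.
  rewrite (hnorm_sub_sym _ l) in T. lra.
Qed.

Lemma hcv_unique (V : Hilbert) (u : nat -> V) (l l' : V) : hcv u l -> hcv u l' -> l = l'.
Proof.
  intros Hl Hl'.
  assert (Hn : hnorm (hsub l l') <= 0).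
  { apply Rnot_lt_le. intros Hpos.
    destruct (hcv_near V u l _ Hl (Rlt_gt _ _ (Rmult_lt_0_compat (/ 2) _ ltac:(lra) Hpos)))
      as [N HN].
    destruct (hcv_near V u l' _ Hl' (Rlt_gt _ _ (Rmult_lt_0_compat (/ 2) _ ltac:(lra) Hpos)))
      as [N' HN'].
    specialize (HN (max N N') ltac:(lia)). specialize (HN' (max N N') ltac:(lia)).
    pose proof (hnorm_sub_triangle _ l (u (max N N')) l') as T.
    rewrite (hnorm_sub_sym _ l (u _)) in T. lra. }
  pose proof (hnorm_ge0 _ (hsub l l')).
  assert (Z : hinner (hsub l l') (hsub l l') = 0) by (rewrite <- hnorm_sq; nra).
  apply hinner_def in Z. apply hinner_ext. intros w.
  apply Rminus_diag_uniq. rewrite <- hinner_sub_l, Z. apply hinner_zero_l.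
Qed.

Lemma hilbert_complete (V : Hilbert) (u : nat -> V) :
  (forall eps, 0 < eps -> exists N, forall m n, (m >= N)%nat -> (n >= N)%nat ->
     hnorm (hsub (u m) (u n)) < eps) -> exists l, hcv u l.
Proof.
  intros Hu. destruct (hcomplete V u Hu) as [l Hl]. exists l.
  intros eps Heps. destruct (Hl eps Heps) as [N HN]. exists N. intros n Hn.
  unfold Rdist. rewrite Rminus_0_r, Rabs_right by apply Rle_ge, hnorm_ge0. now apply HN.
Qed.

Lemma lsc_limit (Y : Hilbert) (f : Y -> ereal) (y : nat -> Y) (yb : Y) (F : nat -> R) (l : R) :
  lsc f -> hcv y yb -> (forall k, f (y k) = Fin (F k)) -> Un_cv F l ->
  exists g, f yb = Fin g /\ g <= l.
Proof.
  intros Hlsc Hy HF Hl.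
  assert (Hno : forall c, l < c -> ~ elt (Fin c) (f yb)).
  { intros c Hlc Hlt. destruct (Hlsc y yb c Hy Hlt) as [N HN].
    destruct (Hl (c - l) ltac:(lra)) as [N' HN'].
    specialize (HN (max N N') ltac:(lia)). specialize (HN' (max N N') ltac:(lia)).
    rewrite HF in HN. simpl in HN. unfold Rdist in HN'. apply Rabs_def2 in HN'. lra. }
  destruct (f yb) as [g|].
  - exists g. split; [reflexivity|]. apply Rnot_lt_le. intros Hlt.
    apply (Hno ((g + l) / 2)); simpl; lra.
  - destruct (Hno (l + 1)); simpl; auto; lra.
Qed.

(** * The iterates *)

Section Iterates.

(* Indices are shifted: [x k], [y k], [lam k], [mu k] below are the ADMM iterates of index
   [k + 1], since optimality and the subgradient relation fail for the initial data. *)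

Variables (X Y H : Hilbert) (A : X -> H) (f : Y -> ereal) (D : X -> Prop) (W : X -> Y).
Variables (c rho1 rho2 fh : R) (b : H) (xh : X).
Variables (x : nat -> X) (y d mu : nat -> Y) (lam : nat -> H).
Hypothesis HA : bounded_linear A.
Hypothesis HW : linear_on D W.
Hypothesis Hc : 0 < c.
Hypothesis Hrho1 : 0 < rho1.
Hypothesis Hrho2 : 0 < rho2.
Hypothesis HxhD : D xh.
Hypothesis HxhA : A xh = b.
Hypothesis Hfh : f (W xh) = Fin fh.
Hypothesis HxD : forall k, D (x k).
Hypothesis Hopt : forall k z, D z ->
  hinner (lam k) (A z) + hinner (hadd (mu k) (hscal rho2 (d k))) (W z) = 0.
Hypothesis Hsub : forall k, strong_subgrad f c (mu k) (y k).
Hypothesis Hlam : forall k, lam (S k) = hadd (lam k) (hscal rho1 (hsub (A (x (S k))) b)).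
Hypothesis Hmu : forall k, mu (S k) = hadd (mu k) (hscal rho2 (hsub (W (x (S k))) (y (S k)))).
Hypothesis Hd : forall k, d (S k) = hsub (y (S k)) (y k).

Let F k := real_of (f (y k)).
Let r k := hsub (A (x k)) b.
Let s k := hsub (W (x k)) (y k).
Let E k := energy rho1 rho2 (r k) (s k) (d k).
Let v k := hsub (W xh) (y k).
Let Phi k := lyapunov rho1 rho2 c fh (F k) (mu k) (v k) (r k) (s k) (d k).

(** * ** One-step inequalities along the iterates *)

Lemma iterate_value k : f (y k) = Fin (F k).
Proof. unfold F. destruct (Hsub k) as [fy [-> _]]. reflexivity. Qed.

Lemma iterate_subgrad k z fz : f z = Fin fz ->
  F k + hinner (mu k) (hsub z (y k)) + c * hinner (hsub z (y k)) (hsub z (y k)) <= fz.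
Proof.
  pose proof (iterate_value k) as Hv. destruct (Hsub k) as [fy [Hfy Hs]].
  rewrite Hfy in Hv. injection Hv as <-. apply Hs.
Qed.

(** Subtracting consecutive optimality conditions leaves only the multiplier updates, which are
    residuals. *)
Lemma iterate_optimality_diff k z : D z ->
  rho1 * hinner (r (S k)) (A z)
  + rho2 * hinner (hsub (hadd (s (S k)) (d (S k))) (d k)) (W z) = 0.
Proof.
  intros Hz. pose proof (Hopt k z Hz) as O1. pose proof (Hopt (S k) z Hz) as O2.
  rewrite Hlam, Hmu in O2. fold (r (S k)) in O2. fold (s (S k)) in O2.
  hexpand_in O1. hexpand_in O2. hexpand. lra.
Qed.

(** The two strong subgradient inequalities between [y k] and [y (S k)] are added; each contributes
    [c |d|^2], and the subgradients differ by [rho2 s]. *)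
Lemma iterate_monotone k :
  2 * c * hinner (d (S k)) (d (S k)) <= rho2 * hinner (s (S k)) (d (S k)).
Proof.
  pose proof (iterate_subgrad k _ _ (iterate_value (S k))) as S1.
  pose proof (iterate_subgrad (S k) _ _ (iterate_value k)) as S2.
  rewrite Hmu in S2. fold (s (S k)) in S2. rewrite Hd.
  hexpand_in S1. hexpand_in S2. hexpand. lra.
Qed.

Lemma iterate_energy_decrease k :
  E (S k) <= E k - 4 * c * hinner (d (S k)) (d (S k)).
Proof.
  apply energy_decrease; auto; [|apply iterate_monotone].
  destruct (linear_on_sub _ _ _ _ (x (S k)) (x k) HW) as [Dz Wz]; auto.
  pose proof (iterate_optimality_diff k _ Dz) as O.
  rewrite Wz, (bounded_linear_sub _ _ _ _ _ HA) in O.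
  replace (hsub (r (S k)) (r k)) with (hsub (A (x (S k))) (A (x k))).
  2:{ apply hinner_ext; intros w. unfold r. hexpand. ring. }
  replace (hadd (hsub (s (S k)) (s k)) (d (S k))) with (hsub (W (x (S k))) (W (x k))).
  2:{ apply hinner_ext; intros w. rewrite Hd. unfold s. hexpand. ring. }
  exact O.
Qed.

Lemma iterate_lyapunov_decrease k : Phi (S k) <= Phi k - / 2 * E (S k).
Proof.
  unfold Phi. rewrite Hmu. fold (s (S k)).
  apply lyapunov_decrease; auto.
  - apply hinner_ext; intros w. unfold v. rewrite Hd. hexpand. ring.
  - rewrite Hd. apply iterate_subgrad, iterate_value.
  (* The test vector is [xh - x (S k)]: [A] maps it to [- r (S k)] by feasibility, and [W] to
     [v (S k) - s (S k)]. *)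
  - destruct (linear_on_sub _ _ _ _ xh (x (S k)) HW) as [Dz Wz]; auto.
    pose proof (iterate_optimality_diff k _ Dz) as O.
    rewrite Wz, (bounded_linear_sub _ _ _ _ _ HA), HxhA in O.
    replace (hsub (v (S k)) (s (S k))) with (hsub (W xh) (W (x (S k)))).
    2:{ apply hinner_ext; intros w. unfold v, s. hexpand. ring. }
    replace (hinner (r (S k)) (r (S k))) with (- hinner (r (S k)) (hsub b (A (x (S k))))).
    2:{ unfold r. hexpand. ring. }
    lra.
  - pose proof (iterate_monotone k) as M. pose proof (hinner_pos Y (d (S k))).
    assert (0 <= 2 * c * hinner (d (S k)) (d (S k))) by (apply Rmult_le_pos; lra).
    apply (Rmult_le_reg_l rho2); lra.
  - apply iterate_energy_decrease.
Qed.

Lemma iterate_lyapunov_lower k : c / 2 * hinner (v k) (v k) <= Phi k.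
Proof. apply lyapunov_lower; auto. now apply iterate_subgrad. Qed.

Lemma iterate_energy_sum n : Phi n + / 2 * sum_f_R0 E n <= Phi 0%nat + / 2 * E 0%nat.
Proof.
  induction n as [|n IH]; [cbn; lra|]. cbn [sum_f_R0].
  pose proof (iterate_lyapunov_decrease n). lra.
Qed.

Lemma iterate_energy_parts k : 0 <= E k /\ rho1 * hnorm (r k) ^ 2 <= E k /\
  rho2 * hnorm (s k) ^ 2 <= E k /\ rho2 * hnorm (d k) ^ 2 <= E k.
Proof.
  unfold E, energy. rewrite !hnorm_sq.
  pose proof (hinner_pos H (r k)). pose proof (hinner_pos Y (s k)).
  pose proof (hinner_pos Y (d k)).
  assert (0 <= rho1 * hinner (r k) (r k)) by (apply Rmult_le_pos; lra).
  assert (0 <= rho2 * hinner (s k) (s k)) by (apply Rmult_le_pos; lra).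
  assert (0 <= rho2 * hinner (d k) (d k)) by (apply Rmult_le_pos; lra).
  repeat split; lra.
Qed.

(** * ** Boundedness and control of the multipliers *)

Lemma iterate_bounded : exists B, forall k, hnorm (v k) <= B.
Proof.
  set (K := Phi 0%nat + / 2 * E 0%nat).
  exists (2 * K / c + 1). intros k.
  pose proof (iterate_lyapunov_lower k) as Hl. pose proof (iterate_energy_sum k) as Hs.
  fold K in Hs. rewrite <- hnorm_sq in Hl.
  pose proof (cond_pos_sum E k (fun j => proj1 (iterate_energy_parts j))).
  assert (c * (2 * K / c) = 2 * K) by (field; lra).
  pose proof (hnorm_ge0 Y (v k)).
  assert (hnorm (v k) ^ 2 <= 2 * K / c) by (apply (Rmult_le_reg_l c); lra).
  nra.
Qed.

Lemma iterate_multiplier_small :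
  exists e : nat -> R, Un_cv e 0 /\ (forall k, e (S k) <= e k) /\
    (forall k, hnorm (r k) <= e k /\ hnorm (s k) <= e k /\ hnorm (d k) <= e k) /\
    Un_cv (fun k => (hnorm (lam k) + hnorm (mu k)) * e k) 0.
Proof.
  (* Since [C] is at least [1] and at least each inverse, [/ rho <= C <= C^2]; a single factor thus
     serves for all three residuals. *)
  set (C := 1 + / rho1 + / rho2).
  assert (I1 : 0 < / rho1) by now apply Rinv_0_lt_compat.
  assert (I2 : 0 < / rho2) by now apply Rinv_0_lt_compat.
  set (e := fun k => C * sqrt (E k)).
  assert (Hpart : forall rho a k, 0 < rho -> / rho <= C -> 0 <= a ->
    rho * a ^ 2 <= E k -> a <= e k).
  { intros rho a k Hr HrC Ha HE. unfold e.
    destruct (iterate_energy_parts k) as [E0 _].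
    apply sq_le_le; [apply Rmult_le_pos; [unfold C; lra | apply sqrt_pos]|].
    rewrite Rpow_mult_distr, pow2_sqrt by auto.
    assert (HrI : 0 < / rho) by now apply Rinv_0_lt_compat.
    apply Rle_trans with (/ rho * E k).
    - apply (Rmult_le_reg_l rho); [auto|]. rewrite <- Rmult_assoc, Rinv_r; lra.
    - apply Rmult_le_compat_r; [auto|]. unfold C in *. nra. }
  assert (Hparts : forall k, hnorm (r k) <= e k /\ hnorm (s k) <= e k /\ hnorm (d k) <= e k).
  { intros k. destruct (iterate_energy_parts k) as [_ [P1 [P2 P3]]].
    repeat split; [apply (Hpart rho1) | apply (Hpart rho2) | apply (Hpart rho2)];
      auto using hnorm_ge0; unfold C; lra. }
  assert (Hdec : forall k, e (S k) <= e k).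
  { intros k. unfold e. apply Rmult_le_compat_l; [unfold C; lra|]. apply sqrt_le_1_alt.
    pose proof (iterate_energy_decrease k). pose proof (hinner_pos Y (d (S k))). nra. }
  exists e.
  destruct (damped_growth_cv0 e (fun k => hnorm (lam k) + hnorm (mu k)) (rho1 + rho2)
    (C ^ 2 * (2 * (Phi 0%nat + / 2 * E 0%nat)))) as [He HL]; auto.
  - lra.
  - intros k. pose proof (hnorm_ge0 _ (r k)). destruct (Hparts k). lra.
  - intros n.
    rewrite (sum_eq _ (fun k => E k * C ^ 2)).
    2:{ intros i _. unfold e. rewrite Rpow_mult_distr, pow2_sqrt by apply iterate_energy_parts.
        ring. }
    rewrite <- scal_sum. apply Rmult_le_compat_l; [apply pow2_ge_0|].
    pose proof (iterate_energy_sum n). pose proof (iterate_lyapunov_lower n).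
    pose proof (hinner_pos Y (v n)).
    assert (0 <= c / 2 * hinner (v n) (v n)) by (apply Rmult_le_pos; lra). lra.
  - intros k. pose proof (hnorm_ge0 _ (lam k)). pose proof (hnorm_ge0 _ (mu k)). lra.
  - intros k. rewrite Hlam, Hmu. fold (r (S k)). fold (s (S k)).
    destruct (Hparts (S k)) as [P1 [P2 _]].
    pose proof (hnorm_triangle _ (lam k) (hscal rho1 (r (S k)))).
    pose proof (hnorm_triangle _ (mu k) (hscal rho2 (s (S k)))).
    rewrite hnorm_scal in * by lra. nra.
Qed.

(* Optimality in [x] converts [mu] tested against [W (z - x m)] into [lam] tested
   against [A (z - x m)], which is of the order of the residuals. *)
Lemma iterate_multiplier_pairing (e B : R) m z u :
  D z -> hnorm (r m) <= e -> hnorm (s m) <= e -> hnorm (d m) <= e ->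
  hnorm (hsub (A z) b) <= e -> hnorm (hsub (W z) u) <= e -> hnorm (hsub u (y m)) <= B ->
  Rabs (hinner (mu m) (hsub u (y m)))
  <= 2 * ((hnorm (lam m) + hnorm (mu m)) * e) + rho2 * (e * (B + 2 * e)).
Proof.
  intros Hz Hr Hs Hdm HAz HWz Hu.
  destruct (linear_on_sub _ _ _ _ z (x m) HW) as [Dz Wz]; auto.
  pose proof (Hopt m _ Dz) as O.
  rewrite Wz, (bounded_linear_sub _ _ _ _ _ HA) in O.
  (* [p] is [A (z - x m)], and [q] is what [W (z - x m)] adds to [u - y m]; both have norm at most
     [2 e]. *)
  set (p := hsub (hsub (A z) b) (r m)).
  set (q := hsub (hsub (W z) u) (s m)).
  replace (hsub (A z) (A (x m))) with p in O.
  2:{ apply hinner_ext; intros w. unfold p, r. hexpand. ring. }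
  replace (hsub (W z) (W (x m))) with (hadd (hsub u (y m)) q) in O.
  2:{ apply hinner_ext; intros w. unfold q, s. hexpand. ring. }
  set (g := hsub u (y m)) in *.
  hexpand_in O.
  assert (Ep : hnorm p <= 2 * e)
    by (unfold p; pose proof (hnorm_sub_le _ (hsub (A z) b) (r m)); lra).
  assert (Eq : hnorm q <= 2 * e)
    by (unfold q; pose proof (hnorm_sub_le _ (hsub (W z) u) (s m)); lra).
  pose proof (cauchy_schwarz _ (lam m) p) as C1.
  pose proof (cauchy_schwarz _ (mu m) q) as C2.
  pose proof (cauchy_schwarz _ (d m) g) as C3.
  pose proof (cauchy_schwarz _ (d m) q) as C4.
  pose proof (hnorm_ge0 _ (d m)). pose proof (hnorm_ge0 _ (lam m)).
  pose proof (hnorm_ge0 _ (mu m)). pose proof (hnorm_ge0 _ q). pose proof (hnorm_ge0 _ g).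
  assert (hnorm (lam m) * hnorm p <= hnorm (lam m) * (2 * e)) by (apply Rmult_le_compat_l; lra).
  assert (hnorm (mu m) * hnorm q <= hnorm (mu m) * (2 * e)) by (apply Rmult_le_compat_l; lra).
  assert (hnorm (d m) * hnorm g <= e * B) by (apply Rmult_le_compat; lra).
  assert (hnorm (d m) * hnorm q <= e * (2 * e)) by (apply Rmult_le_compat; lra).
  assert (hinner (mu m) g = - hinner (lam m) p - hinner (mu m) q
    - rho2 * (hinner (d m) g + hinner (d m) q)) as -> by lra.
  pose proof (abs_bounds _ _ C1). pose proof (abs_bounds _ _ C2).
  pose proof (abs_bounds _ _ C3). pose proof (abs_bounds _ _ C4).
  assert (Hdsum : - (e * (B + 2 * e)) <= hinner (d m) g + hinner (d m) q <= e * (B + 2 * e))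
    by lra.
  apply Rabs_le. nra.
Qed.

(** The pairing bound is used with [z = x n], [u = y n] and with [z = xh], [u = W xh]. As [e] is
    nonincreasing, residuals at [n >= m] are bounded by [e m], so [eta] depends on [m] alone; [2 B]
    bounds [|y n - y m|] through [W xh]. *)
Lemma iterate_asymptotics :
  exists e eta : nat -> R, Un_cv e 0 /\ Un_cv eta 0 /\
    (forall k, hnorm (r k) <= e k /\ hnorm (s k) <= e k) /\
    (forall m n, (m <= n)%nat -> Rabs (hinner (mu m) (hsub (y n) (y m))) <= eta m) /\
    (forall m, Rabs (hinner (mu m) (hsub (W xh) (y m))) <= eta m).
Proof.
  destruct iterate_multiplier_small as [e [He [Hdec [Hparts HL]]]].
  destruct iterate_bounded as [B HB].
  exists e, (fun m => 2 * ((hnorm (lam m) + hnorm (mu m)) * e m)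
    + rho2 * (e m * (2 * B + 2 * e m))).
  assert (Hanti : forall m n, (m <= n)%nat -> e n <= e m).
  { intros m n Hmn. induction Hmn as [|n Hmn IH]; [lra|]. specialize (Hdec n). lra. }
  assert (HB0 : 0 <= B) by (specialize (HB 0%nat); pose proof (hnorm_ge0 Y (v 0%nat)); lra).
  split; [exact He|]. split; [|split; [|split]].
  - replace 0 with (2 * 0 + rho2 * (0 * (2 * B + 2 * 0))) by ring.
    apply CV_plus; [apply CV_mult; [apply cv_const | exact HL]|].
    apply CV_mult; [apply cv_const|]. apply CV_mult; [exact He|].
    apply CV_plus; [apply cv_const|]. apply CV_mult; [apply cv_const | exact He].
  - intros k. destruct (Hparts k) as [P1 [P2 _]]. auto.
  - intros m n Hmn. destruct (Hparts m) as [P1 [P2 P3]]. destruct (Hparts n) as [Q1 [Q2 _]].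
    specialize (Hanti m n Hmn).
    apply iterate_multiplier_pairing with (z := x n); auto.
    + fold (r n). lra.
    + fold (s n). lra.
    + pose proof (hnorm_sub_triangle _ (y n) (W xh) (y m)) as T.
      rewrite (hnorm_sub_sym _ (y n) (W xh)) in T. fold (v n) (v m) in T.
      pose proof (HB n). pose proof (HB m). lra.
  - intros m. destruct (Hparts m) as [P1 [P2 P3]].
    assert (Z : forall (V : Hilbert) (a : V), hnorm (hsub a a) <= e m).
    { intros V a. replace (hnorm (hsub a a)) with 0.
      - pose proof (hnorm_ge0 _ (r m)). lra.
      - unfold hnorm. hexpand. symmetry.
        replace (hinner a a - hinner a a - (hinner a a - hinner a a)) with 0 by ring.
        apply sqrt_0. }
    apply iterate_multiplier_pairing with (z := xh); auto.
    + rewrite HxhA. apply Z.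
    + specialize (HB m). unfold v in HB. lra.
Qed.

(** * ** Passage to the limit *)

Hypothesis Hlsc : lsc f.
Hypothesis Hclosed : closed_operator D W.
Variable c1 : R.
Hypothesis Hc1 : 0 < c1.
Hypothesis Hcoer : forall u, D u -> hnorm (A u) ^ 2 + hnorm (W u) ^ 2 >= c1 * hnorm u ^ 2.
Hypothesis Hmin : forall u, D u -> A u = b -> ele (Fin fh) (f (W u)).

Lemma coercive_sub u w : D u -> D w ->
  sqrt c1 * hnorm (hsub u w) <= hnorm (hsub (A u) (A w)) + hnorm (hsub (W u) (W w)).
Proof.
  intros Hu Hw. destruct (linear_on_sub _ _ _ _ u w HW Hu Hw) as [Dz Wz].
  pose proof (Hcoer _ Dz) as Q. rewrite Wz, (bounded_linear_sub _ _ _ _ _ HA) in Q.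
  pose proof (hnorm_ge0 _ (hsub (A u) (A w))). pose proof (hnorm_ge0 _ (hsub (W u) (W w))).
  apply sq_le_le; [lra|]. rewrite Rpow_mult_distr, pow2_sqrt by lra. nra.
Qed.

(* Along a feasible limit point, lower semicontinuity and minimality pin the limit of
   the values [F]. *)
Lemma iterate_value_cv : Un_cv F fh.
Proof.
  destruct iterate_asymptotics as [e [eta [He [Heta [Hres [Hpair Hpairh]]]]]].
  assert (Hinc : forall m n, (m <= n)%nat ->
    F m + c * hnorm (hsub (y n) (y m)) ^ 2 <= F n + eta m).
  { intros m n Hmn. rewrite hnorm_sq.
    pose proof (iterate_subgrad m _ _ (iterate_value n)).
    pose proof (abs_bounds _ _ (Hpair m n Hmn)). lra. }
  assert (Hup : forall m, F m <= fh + eta m).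
  { intros m. pose proof (iterate_subgrad m _ _ Hfh). pose proof (abs_bounds _ _ (Hpairh m)).
    pose proof (hinner_pos Y (hsub (W xh) (y m))).
    assert (0 <= c * hinner (hsub (W xh) (y m)) (hsub (W xh) (y m)))
      by (apply Rmult_le_pos; lra). lra. }
  destruct (maj_by_pos eta (exist (Un_cv eta) 0 Heta)) as [M [_ HM]].
  destruct (almost_increasing_cv F eta (fh + M)) as [l Hl]; auto.
  { intros n. pose proof (abs_bounds _ _ (HM n)). specialize (Hup n). lra. }
  { intros m n Hmn. specialize (Hinc m n Hmn).
    pose proof (pow2_ge_0 (hnorm (hsub (y n) (y m)))). nra. }
  assert (Hlfh : l <= fh).
  { apply (@Rle_cv_lim F (fun m => fh + eta m) l fh Hup Hl).
    pose proof (CV_plus _ _ _ _ (cv_const fh) Heta) as Q.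
    rewrite Rplus_0_r in Q. exact Q. }
  destruct (hilbert_complete Y y) as [yb Hyb].
  (* For [m <= n], [c |y n - y m|^2] is at most [F n - F m + eta m], which is small because [F] is
     Cauchy. *)
  { intros eps Heps.
    assert (Hpos : 0 < c * eps ^ 2 / 2)
      by (apply Rdiv_lt_0_compat; [apply Rmult_lt_0_compat; nra | lra]).
    destruct (CV_Cauchy _ (exist _ l Hl) _ Hpos) as [N1 HN1].
    destruct (Heta _ Hpos) as [N2 HN2].
    exists (max N1 N2).
    assert (Hord : forall m n, (max N1 N2 <= m <= n)%nat -> hnorm (hsub (y n) (y m)) < eps).
    { intros m n Hmn. specialize (HN1 n m ltac:(lia) ltac:(lia)).
      specialize (HN2 m ltac:(lia)). specialize (Hinc m n ltac:(lia)).
      unfold Rdist in *. rewrite Rminus_0_r in HN2.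
      apply Rabs_def2 in HN1, HN2. pose proof (hnorm_ge0 _ (hsub (y n) (y m))).
      assert (hnorm (hsub (y n) (y m)) ^ 2 < eps ^ 2) by (apply (Rmult_lt_reg_l c); lra).
      nra. }
    intros m n Hm Hn. destruct (Nat.le_ge_cases m n).
    - rewrite hnorm_sub_sym. apply Hord. lia.
    - apply Hord. lia. }
  assert (Hyb0 : Un_cv (fun n => e n + hnorm (hsub (y n) yb)) 0).
  { replace 0 with (0 + 0) by ring. now apply CV_plus. }
  assert (HWx : hcv (fun n => W (x n)) yb).
  { apply hcv_squeeze with (2 := Hyb0). intros n. destruct (Hres n) as [_ P].
    pose proof (hnorm_sub_triangle _ (W (x n)) (y n) yb). unfold s in P. lra. }
  assert (HAx : hcv (fun n => A (x n)) b).
  { apply hcv_squeeze with (2 := He). intros n. apply Hres. }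
  assert (Hk : 0 < sqrt c1) by now apply sqrt_lt_R0.
  destruct (hilbert_complete X x) as [xb Hxb].
  { intros eps Heps.
    assert (Hpos : 0 < sqrt c1 * eps / 2)
      by (apply Rdiv_lt_0_compat; [apply Rmult_lt_0_compat|]; lra).
    destruct (hcv_cauchy _ _ _ HWx _ Hpos) as [N1 HN1].
    destruct (hcv_cauchy _ _ _ HAx _ Hpos) as [N2 HN2].
    exists (max N1 N2). intros m n Hm Hn.
    specialize (HN1 m n ltac:(lia) ltac:(lia)). specialize (HN2 m n ltac:(lia) ltac:(lia)).
    pose proof (coercive_sub (x m) (x n) (HxD m) (HxD n)).
    apply (Rmult_lt_reg_l (sqrt c1)); lra. }
  destruct (Hclosed x xb yb HxD Hxb HWx) as [Dxb Wxb].
  assert (Axb : A xb = b).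
  { apply (hcv_unique _ (fun n => A (x n))); [|exact HAx].
    pose proof HA as HA'. destruct HA' as [_ [_ [K HK]]].
    apply hcv_squeeze with (a := fun n => K * hnorm (hsub (x n) xb)).
    - intros n. rewrite <- (bounded_linear_sub _ _ _ _ _ HA). apply HK.
    - replace 0 with (K * 0) by ring. apply CV_mult; [apply cv_const | exact Hxb]. }
  destruct (lsc_limit Y f y yb F l Hlsc Hyb iterate_value Hl) as [g [Hg Hgl]].
  (* Minimality closes the chain [fh <= g <= l <= fh]. *)
  pose proof (Hmin xb Dxb Axb) as Hm. rewrite Wxb, Hg in Hm. simpl in Hm.
  replace fh with l by lra. exact Hl.
Qed.

Lemma iterate_convergence :
  hcv x xh /\ hcv y (W xh) /\ hcv (fun k => W (x k)) (W xh) /\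
  ecv (fun k => f (y k)) (f (W xh)) /\
  Un_cv (fun k => bregman f (mu k) (W xh) (y k)) 0.
Proof.
  pose proof iterate_value_cv as HF.
  destruct iterate_asymptotics as [e [eta [He [Heta [Hres [_ Hpairh]]]]]].
  assert (Hgap : Un_cv (fun k => fh - F k) 0).
  { replace 0 with (fh - fh) by ring. apply CV_minus; [apply cv_const | exact HF]. }
  (* Tested at [W xh], the strong subgradient inequality bounds [c |W xh - y k|^2] by the value gap
     plus [eta k]. *)
  assert (Hy : hcv y (W xh)).
  { apply hcv_of_sq with (c := c) (a := fun k => fh - F k + eta k); [exact Hc| |].
    - intros k. rewrite hnorm_sub_sym, hnorm_sq.
      pose proof (iterate_subgrad k _ _ Hfh). pose proof (abs_bounds _ _ (Hpairh k)). lra.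
    - replace 0 with (0 + 0) by ring. now apply CV_plus. }
  assert (HWx : Un_cv (fun k => e k + hnorm (hsub (y k) (W xh))) 0).
  { replace 0 with (0 + 0) by ring. now apply CV_plus. }
  assert (Hbd : forall k, hnorm (hsub (W (x k)) (W xh)) <= e k + hnorm (hsub (y k) (W xh))).
  { intros k. destruct (Hres k) as [_ P].
    pose proof (hnorm_sub_triangle _ (W (x k)) (y k) (W xh)). unfold s in P. lra. }
  assert (Hk : 0 < sqrt c1) by now apply sqrt_lt_R0.
  split; [|split; [exact Hy|split; [|split]]].
  - apply hcv_squeeze
      with (a := fun k => / sqrt c1 * (e k + (e k + hnorm (hsub (y k) (W xh))))).
    + intros k. apply (Rmult_le_reg_l (sqrt c1)); [exact Hk|].
      rewrite <- Rmult_assoc, Rinv_r, Rmult_1_l by lra.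
      pose proof (coercive_sub (x k) xh (HxD k) HxhD) as Q. rewrite HxhA in Q.
      destruct (Hres k) as [P _]. unfold r in P. specialize (Hbd k). lra.
    + replace 0 with (/ sqrt c1 * (0 + 0)) by ring.
      apply CV_mult; [apply cv_const|]. now apply CV_plus.
  - now apply hcv_squeeze with (2 := HWx).
  - rewrite Hfh. split; [|exact HF].
    exists 0%nat. intros n _. exists (F n). apply iterate_value.
  - assert (Hz : Un_cv (fun k => hinner (mu k) (hsub (W xh) (y k))) 0).
    { now apply (cv0_squeeze _ eta). }
    replace 0 with (0 - 0) by ring. unfold bregman. rewrite Hfh. cbn [real_of].
    exact (CV_minus _ _ _ _ Hgap Hz).
Qed.

End Iterates.

Theorem theorem2p7
  (X Y H : Hilbert) (A : X -> H) (f : Y -> ereal) (DW : X -> Prop) (W : X -> Y)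
  (c0 c1 : R)
  (* (A1) *)
  (HA : bounded_linear A)
  (* (A2) *)
  (Hproper : proper f) (Hlsc : lsc f) (Hc0 : c0 > 0) (Hsc : strongly_convex f c0)
  (* (A3) *)
  (HWlin : linear_on DW W) (HWdense : densely_defined DW) (HWclosed : closed_operator DW W)
  (* (A4) *)
  (Hc1 : c1 > 0)
  (HA4 : forall x, DW x -> (hnorm (A x)) ^ 2 + (hnorm (W x)) ^ 2 >= c1 * (hnorm x) ^ 2)
  (b : H)
  (* b consistent *)
  (Hb : exists x, DW x /\ A x = b /\ in_dom f (W x))
  (* x* solves min { f(Wx) : x in D(W), Ax = b } *)
  (xs : X) (HxsD : DW xs) (HxsA : A xs = b)
  (Hxsmin : forall x, DW x -> A x = b -> ele (f (W xs)) (f (W x)))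
  (* ADMM iterates *)
  (rho1 rho2 : R) (Hrho1 : rho1 > 0) (Hrho2 : rho2 > 0)
  (x : nat -> X) (y : nat -> Y) (lam : nat -> H) (mu : nat -> Y)
  (Hxstep : forall k, DW (x (S k)) /\
     forall z, DW z -> admm_x_obj A W b rho1 rho2 (lam k) (mu k) (y k) (x (S k))
                       <= admm_x_obj A W b rho1 rho2 (lam k) (mu k) (y k) z)
  (Hystep : forall k, forall z,
     ele (admm_y_obj f rho2 (mu k) (W (x (S k))) (y (S k)))
         (admm_y_obj f rho2 (mu k) (W (x (S k))) z))
  (Hlam : forall k, lam (S k) = hadd (lam k) (hscal rho1 (hsub (A (x (S k))) b)))
  (Hmu : forall k, mu (S k) = hadd (mu k) (hscal rho2 (hsub (W (x (S k))) (y (S k))))) :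
  hcv x xs /\
  hcv y (W xs) /\
  hcv (fun k => W (x k)) (W xs) /\
  ecv (fun k => f (y k)) (f (W xs)) /\
  Un_cv (fun k => bregman f (mu k) (W xs) (y k)) 0.

Proof.
  assert (Hfin : exists fh, f (W xs) = Fin fh).
  { destruct Hb as [u [Du [Au [ru Hru]]]]. specialize (Hxsmin u Du Au).
    rewrite Hru in Hxsmin. destruct (f (W xs)) as [fh|]; [now exists fh | easy]. }
  destruct Hfin as [fh Hfh].
  assert (Hopt : forall k z, DW z -> hinner (lam (S k)) (A z)
    + hinner (hadd (mu (S k)) (hscal rho2 (hsub (y (S k)) (y k)))) (W z) = 0).
  { intros k z Hz. destruct (Hxstep k) as [Dx Hx].
    rewrite <- (admm_x_optimality X Y H A DW W b rho1 rho2 (lam k) (mu k) (y k) (x (S k)) z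
      HA HWlin Dx Hz Hx).
    rewrite Hlam, Hmu. hexpand. ring. }
  assert (Hsub : forall k, strong_subgrad f c0 (mu (S k)) (y (S k))).
  { intros k. rewrite Hmu. apply prox_strong_subgrad; auto. }
  (* The increment with shifted index 0 is [y 1 - y 0], so the initial [y 0] enters only through
     [d]. *)
  destruct (iterate_convergence X Y H A f DW W c0 rho1 rho2 fh b xs
    (fun k => x (S k)) (fun k => y (S k)) (fun k => hsub (y (S k)) (y k))
    (fun k => mu (S k)) (fun k => lam (S k))) with (c1 := c1)
    as [Cx [Cy [CW [CF CB]]]]; auto.
  - intros k. apply Hxstep.
  - intros u Du Au. rewrite <- Hfh. auto.
  - rewrite Hfh in *. destruct CF as [[N HN] CF].
    split; [|split; [|split; [|split; [split|]]]]; try (now apply cv_unshift).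
    (* [f (y 0)] may be infinite, so finiteness is claimed only from index [S N] on. *)
    exists (S N). intros [|n] Hn; [lia|]. apply HN. lia.
Qed.
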